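(* For all positive integers $d$ and $p$, (i) $\displaystyle \left|B(d,p)\cap\mathbb{P}^d_\circ\right|=\frac{1}{2}\sum_{j=1}^{d}2^j\binom{d}{j}\sum_{i=j}^{p}c_\psi(i,j)$, and (ii) $\displaystyle \kappa\!\left(B(d,p)\cap\mathbb{P}^d_\circ\right)=\frac{1}{2d}\sum_{j=1}^{d}2^j\binom{d}{j}\sum_{i=j}^{p}i\,c_\psi(i,j)$, where for positive integers $p,d$, $$c_\psi(p,d)=\frac{1}{(d-1)!}\sum_{i=1}^{d}s(d,i)\,J_{i-1}(p).$$
   Context: A point of $\mathbb{Z}^d$ is primitive if its coordinates are relatively prime; $\mathbb{P}^d$ is the set of primitive points of $\mathbb{Z}^d$, and $\mathbb{P}^d_\circ$ is the set of points of $\mathbb{P}^d$ whose first non-zero coordinate is positive. $B(d,p)=\{x\in\mathbb{R}^d:\|x\|_1\le p\}$. For a finite set $\mathcal{X}\subset\mathbb{R}^d$, $\kappa(\mathcal{X})=\max_{1\le i\le d}\sum_{x\in\mathcal{X}}|x_i|$. $J_q$ is Jordan's totient function: $J_q(p)=p^q\prod_{n}(1-n^{-q})$, the product over the primes $n$ dividing $p$ (so $J_0(1)=1$ and $J_0(p)=0$ for $p>1$). $s(d,i)$ are the (signed) Stirling numbers of the first kind, given by $s(d+1,i)=-d\,s(d,i)+s(d,i-1)$, $s(i,i)=1$, and $s(d,0)=0$ for $d>0$. *)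

(* Defs.v *)
From HB Require Import structures.
From mathcomp Require Import all_boot all_order all_algebra.
Set Implicit Arguments. Unset Strict Implicit. Unset Printing Implicit Defensive.
Import Order.TTheory GRing.Theory Num.Theory.
Local Open Scope ring_scope.

Definition primitive (d : nat) (x : 'rV[int]_d) : bool :=
  (\big[gcdz/0%Z]_(i < d) x ord0 i) == 1%Z.

Definition first_nz_pos (d : nat) (x : 'rV[int]_d) : bool :=
  [exists i : 'I_d, (0 < x ord0 i) && [forall j : 'I_d, (j < i)%N ==> (x ord0 j == 0)]].

Definition in_B (d p : nat) (x : 'rV[int]_d) : bool :=
  \sum_(i < d) `|x ord0 i| <= p%:Z.

(* the finite box [-p,p]^d, which contains B(d,p) ∩ Z^d *)
Definition box (d p : nat) : seq 'rV[int]_d :=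
  [seq \row_i ((f i : nat)%:Z - p%:Z) | f : {ffun 'I_d -> 'I_(2 * p).+1}].

Definition BP (d p : nat) : seq 'rV[int]_d :=
  undup [seq x <- box d p | [&& in_B p x, primitive x & first_nz_pos x]].

Definition kappa (d : nat) (X : seq 'rV[int]_d) : nat :=
  (\max_(i < d) \sum_(x <- X) `|x ord0 i|%N)%N.

Definition jordan (q p : nat) : rat :=
  (p%:R ^+ q) * \prod_(n <- primes p) (1 - (n%:R ^+ q)^-1).

Fixpoint stirling1 (n k : nat) : int :=
  match n, k with
  | 0, 0 => 1
  | 0, _ => 0
  | n'.+1, 0 => 0
  | n'.+1, k'.+1 => - (n'%:Z) * stirling1 n' k'.+1 + stirling1 n' k'
  end.

Definition cpsi (p d : nat) : rat :=
  ((d.-1)`!%:R)^-1 * \sum_(1 <= i < d.+1) (stirling1 d i)%:~R * jordan i.-1 p.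

(* Main.v *)
Require Import Defs.
From HB Require Import structures.
From mathcomp Require Import all_boot all_order all_algebra.
From mathcomp Require Import perm ring zify.
Import Order.TTheory GRing.Theory Num.Theory.
Local Open Scope ring_scope.

(* The number of points of Z^d with 1-norm n > 0 is the coefficient of X^n in
   (1 + 2 (X + X^2 + ...))^d, that is, the sum over j of 2^j C(d, j) C(n-1, j-1).
   Dividing such a point by the gcd of its coordinates shows that this number is
   also the sum, over the divisors e of n, of the number of primitive points of
   norm e.  On the other side, the sum over e | n of J_q(e) is n^q, so that the
   sum over e | n of c_psi(e, j) is (1/(j-1)!) times the sum of s(j, i) n^(i-1),
   which is C(n-1, j-1).  By uniqueness of Moebius inversion the number of
   primitive points of norm n is the sum of 2^j C(d, j) c_psi(n, j), and (i)
   follows by symmetry under x -> -x.  For (ii), permuting the coordinates of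
   all primitive points shows that the d coordinate sums are equal; hence each
   of them is 1/d times the sum of the norms. *)

(** * Stirling numbers of the first kind and falling factorials *)

Lemma stirling1_gt n k : (n < k)%N -> stirling1 n k = 0.
Proof.
elim: n k => [|n IHn] [|k] //= ltnk.
by rewrite !IHn ?mulr0 ?add0r // ltnW.
Qed.

(** The recurrence for s(n+1, i) is multiplication of the polynomial by x - n, read off coefficient
    by coefficient. *)
Lemma sum_stirling1 (x : rat) n :
  \sum_(0 <= i < n.+1) (stirling1 n i)%:~R * x ^+ i = \prod_(k < n) (x - k%:R).
Proof.
elim: n => [|n IHn]; first by rewrite big_nat1 big_ord0 expr0 mulr1.
rewrite big_ord_recr -IHn /= big_nat_recl //= mul0r add0r.
under eq_bigr => i _ do rewrite intrD intrM intrN mulrDl.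
rewrite big_split /= [X in X + _]big_nat_recr //= stirling1_gt // mulr0 mul0r addr0.
have -> : \sum_(0 <= i < n) (- n%:~R * (stirling1 n i.+1)%:~R * x ^+ i.+1)
   = - n%:R * \sum_(0 <= i < n.+1) (stirling1 n i)%:~R * x ^+ i :> rat.
  rewrite big_nat_recl // mulrDr.
  (* The added constant term is zero: the factor n vanishes for n = 0, and s(n, 0) = 0 otherwise. *)
  have -> : - n%:R * ((stirling1 n 0)%:~R * x ^+ 0) = 0.
    by case: n {IHn} => [|n] /=; rewrite ?mul0r ?mulr0 // oppr0 mul0r.
  by rewrite add0r big_distrr; apply: eq_bigr => i _; rewrite /= mulrA.
rewrite mulrBr addrC mulNr [RHS]addrC [_ * n%:R]mulrC addrC; congr (_ + _).
by rewrite big_distrl /=; apply: eq_bigr => i _; rewrite exprSr mulrA.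
Qed.

Lemma prod_sub_ffact n k : \prod_(i < k) (n%:R - i%:R) = (n ^_ k)%:R :> rat.
Proof.
have [lekn|ltnk] := leqP k n; last first.
  by rewrite ffact_small // (bigD1 (Ordinal ltnk)) //= subrr mul0r.
rewrite ffact_prod natr_prod; apply: eq_bigr => i _.
by rewrite natrB // ltnW // (leq_trans (ltn_ord i)).
Qed.

(** After multiplication by n the left side is the whole falling factorial of n, because s(k, 0) = 0
    for k > 0. *)
Lemma sum_stirling1_bin n k : (0 < n)%N -> (0 < k)%N ->
  \sum_(1 <= i < k.+1) (stirling1 k i)%:~R * n%:R ^+ i.-1 =
  k.-1`!%:R * 'C(n.-1, k.-1)%:R :> rat.
Proof.
case: n k => [|n] // [|k] // _ _.
have n0 : n.+1%:R != 0 :> rat by rewrite pnatr_eq0.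
apply: (mulfI n0); rewrite -!natrM [(k.+1.-1`! * _)%N]mulnC bin_ffact -ffactSS.
rewrite -prod_sub_ffact -sum_stirling1 [RHS]big_nat_recl //= mul0r add0r big_add1 /= big_distrr /=.
by apply: eq_bigr => i _; rewrite exprS mulrCA.
Qed.

(** * Divisor sums of Jordan's totient *)

Lemma jordan1 q : jordan q 1 = 1.
Proof. by rewrite /jordan big_nil expr1n mulr1. Qed.

Lemma jordanM q m n : (0 < m)%N -> (0 < n)%N -> coprime m n ->
  jordan q (m * n) = jordan q m * jordan q n.
Proof.
move=> m0 n0 cop; rewrite /jordan natrM exprMn mulrACA; congr (_ * _).
rewrite -big_cat /=; apply: perm_big; apply: uniq_perm.
- exact: primes_uniq.
- rewrite cat_uniq !primes_uniq /= andbT.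
  by rewrite coprime_has_primes // in cop.
by move=> l; rewrite primesM // mem_cat.
Qed.

(** The sum telescopes: for a > 0, J_q(l^a) is l^(aq) - l^((a-1)q). *)
Lemma sum_jordan_pfactor q l k : prime l ->
  \sum_(0 <= a < k.+1) jordan q (l ^ a) = (l ^ k)%:R ^+ q.
Proof.
move=> pl; elim: k => [|k IHk]; first by rewrite big_nat1 jordan1 expr1n.
rewrite big_nat_recr //= IHk /jordan primesX // primes_prime // big_seq1.
have l0 : l%:R ^+ q != 0 :> rat by rewrite expf_neq0 // pnatr_eq0 -lt0n prime_gt0.
rewrite expnS natrM exprMn mulrBr mulr1 mulrAC divff // mul1r; ring.
Qed.

Lemma divisors_pfactorM l k m : prime l -> (0 < m)%N -> coprime l m ->
  perm_eq (divisors (l ^ k * m))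
    [seq (l ^ a * e)%N | a <- iota 0 k.+1, e <- divisors m].
Proof.
move=> pl m0 cop; have l0 := prime_gt0 pl.
have ndvd e : (e %| m)%N -> ~~ (l %| e)%N.
  move=> em; rewrite -prime_coprime //.
  exact: coprime_dvdr em cop.
apply: uniq_perm; first exact: divisors_uniq.
  apply: allpairs_uniq; [exact: iota_uniq|exact: divisors_uniq|].
  move=> _ _ /allpairsPdep[a' [e' [_ + ->]]] /allpairsPdep[b' [f' [_ + ->]]].
  rewrite -!dvdn_divisors // => em fm; rewrite /uncurry => eqef.
  (* The exponent of [l] is recovered from the product, so the factorization is unique. *)
  have lg c g : (g %| m)%N -> logn l (l ^ c * g) = c.
    move=> gm; rewrite lognM ?expn_gt0 ?l0 ?(dvdn_gt0 m0) // pfactorK //.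
    by rewrite (lognE l g) (negPf (ndvd _ gm)) !andbF addn0.
  have ab : a' = b' by rewrite -(lg a' e' em) eqef lg.
  move: eqef; rewrite ab => /eqP; rewrite eqn_pmul2l ?expn_gt0 ?l0 // => /eqP ->.
  by [].
move=> x; rewrite -dvdn_divisors ?muln_gt0 ?expn_gt0 ?l0 //.
apply/idP/allpairsPdep => [xd|[a [e [+ + ->]]]]; last first.
  rewrite mem_iota add0n ltnS -dvdn_divisors // => lea em.
  by rewrite dvdn_mul // dvdn_exp2l.
have x0 : (0 < x)%N by rewrite (dvdn_gt0 _ xd) // muln_gt0 expn_gt0 l0.
have [e ce xE] := pfactor_coprime pl x0.
exists (logn l x), e; split; last by rewrite mulnC.
- rewrite mem_iota add0n ltnS.
  have := dvdn_leq_log l _ xd; rewrite muln_gt0 expn_gt0 l0 m0 => /(_ isT).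
  rewrite lognM ?expn_gt0 ?l0 // pfactorK // (lognE l m) (negPf (ndvd _ (dvdnn m))).
  by rewrite !andbF addn0.
rewrite -dvdn_divisors //; move: xd; rewrite {1}xE => xd.
have : (e %| l ^ k * m)%N by apply: dvdn_trans xd; apply: dvdn_mulr.
by rewrite Gauss_dvdr // coprime_sym coprimeXl.
Qed.

(** Strong induction on n: splitting off the full power of the smallest prime factor factors the
    divisor sum, by multiplicativity. *)
Lemma sum_jordan q n : (0 < n)%N ->
  \sum_(e <- divisors n) jordan q e = n%:R ^+ q.
Proof.
elim/ltn_ind: n => n IHn n0.
have [n1|n_neq1] := eqVneq n 1%N; first by rewrite n1 big_seq1 jordan1 expr1n.
have n_gt1 : (1 < n)%N by rewrite ltn_neqAle eq_sym n_neq1.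
have pl := pdiv_prime n_gt1; set l := pdiv n in pl.
have [m cop nE] := pfactor_coprime pl n0.
have m0 : (0 < m)%N by case: m {cop} nE n0 => // ->.
have k0 : (0 < logn l n)%N by rewrite -pfactor_dvdn // expn1 pdiv_dvd.
rewrite nE mulnC (perm_big _ (divisors_pfactorM _ _ _ pl m0 cop)) big_allpairs_dep.
have ltmn : (m < n)%N.
  by rewrite nE -{1}(muln1 m) ltn_pmul2l // -(expn0 l) ltn_exp2l // prime_gt1.
rewrite natrM exprMn -sum_jordan_pfactor // -(IHn m) // big_distrlr /=.
apply: eq_bigr => a _; rewrite [LHS]big_seq [RHS]big_seq; apply: eq_bigr => e.
rewrite -dvdn_divisors // => em; rewrite jordanM ?(dvdn_gt0 m0 em) ?expn_gt0 ?(prime_gt0 pl) //.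
by rewrite coprimeXl //; apply: coprime_dvdr em cop.
Qed.

(** * Divisor sums of c_psi and uniqueness of Moebius inversion *)

Lemma sum_cpsi n k : (0 < n)%N -> (0 < k)%N ->
  \sum_(e <- divisors n) cpsi e k = 'C(n.-1, k.-1)%:R.
Proof.
move=> n0 k0; rewrite /cpsi -big_distrr /= exchange_big /=.
under eq_bigr => i _ do rewrite -big_distrr sum_jordan //.
by rewrite sum_stirling1_bin // mulKf // pnatr_eq0 -lt0n fact_gt0.
Qed.

(** By strong induction the terms at proper divisors of n agree, which leaves the term at n. The
    bound [p] serves [cpsi_small], where the divisor sums vanish only on an initial range. *)
Lemma eq_divisor_sum (V : zmodType) (u v : nat -> V) p :
  (forall n, (0 < n <= p)%N ->
     \sum_(e <- divisors n) u e = \sum_(e <- divisors n) v e) ->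
  forall n, (0 < n <= p)%N -> u n = v n.
Proof.
move=> eq_sum; elim/ltn_ind => n IHn np; have /andP[n0 len] := np.
have := eq_sum n np.
have nn : n \in divisors n by rewrite -dvdn_divisors.
rewrite !(bigD1_seq n) ?divisors_uniq //=.
have -> : \sum_(e <- divisors n | e != n) u e = \sum_(e <- divisors n | e != n) v e.
  rewrite big_seq_cond [RHS]big_seq_cond; apply: eq_bigr => e /andP[].
  rewrite -dvdn_divisors // => en ne; have len' := dvdn_leq n0 en.
  by apply: IHn; rewrite ?(dvdn_gt0 n0 en) ?ltn_neqAle ?ne ?(leq_trans len').
exact: addIr.
Qed.

Lemma cpsi_small n k : (0 < n < k)%N -> cpsi n k = 0.
Proof.
case: k => [|k] /andP[n0 nk] //.
apply: (@eq_divisor_sum _ (cpsi^~ k.+1) (fun=> 0) k); last by rewrite n0.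
by move=> m /andP[m0 mk]; rewrite sum_cpsi // big1 // bin_small //=; case: m m0 mk.
Qed.

(** * Norm and content of integer vectors *)

Definition norm1 {d : nat} (x : 'rV[int]_d) : nat := (\sum_(i < d) `|x ord0 i|)%N.

Definition content {d : nat} (x : 'rV[int]_d) : nat :=
  \big[gcdn/0%N]_(i < d) `|x ord0 i|%N.

Lemma in_BE (d p : nat) (x : 'rV[int]_d) : in_B p x = (norm1 x <= p)%N.
Proof.
rewrite /in_B /norm1 -lez_nat; congr (_ <= _).
by rewrite -[RHS]natz natr_sum; apply: eq_bigr => i _; rewrite natz abszE.
Qed.

Lemma primitiveE (d : nat) (x : 'rV[int]_d) : primitive x = (content x == 1%N).
Proof.
rewrite /primitive /content.
have -> : \big[gcdz/0%Z]_(i < d) x ord0 i = \big[gcdn/0%N]_(i < d) `|x ord0 i|%N.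
  elim/big_rec2: _ => // i m n _ ->.
  by rewrite /gcdz.
by [].
Qed.

Lemma leq_norm1 (d : nat) (x : 'rV[int]_d) i : (`|x ord0 i| <= norm1 x)%N.
Proof. by rewrite /norm1 (bigD1 i) //= leq_addr. Qed.

Lemma norm1N (d : nat) (x : 'rV[int]_d) : norm1 (- x) = norm1 x.
Proof. by apply: eq_bigr => i _; rewrite mxE abszN. Qed.

Lemma contentN (d : nat) (x : 'rV[int]_d) : content (- x) = content x.
Proof. by apply: eq_bigr => i _; rewrite mxE abszN. Qed.

Lemma norm1Z (d c : nat) (x : 'rV[int]_d) : norm1 (c%:Z *: x) = (c * norm1 x)%N.
Proof. by rewrite /norm1 big_distrr; apply: eq_bigr => i _; rewrite mxE abszM. Qed.

Lemma contentZ (d c : nat) (x : 'rV[int]_d) : content (c%:Z *: x) = (c * content x)%N.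
Proof.
rewrite /content (big_morph (muln c) (muln_gcdr c) (muln0 c)).
by apply: eq_bigr => i _; rewrite mxE abszM.
Qed.

Lemma norm1_perm (d : nat) (s : {perm 'I_d}) (x : 'rV[int]_d) :
  norm1 (col_perm s x) = norm1 x.
Proof.
rewrite /norm1 [RHS](reindex_perm s).
by apply: eq_bigr => i _; rewrite mxE.
Qed.

Lemma content_perm (d : nat) (s : {perm 'I_d}) (x : 'rV[int]_d) :
  content (col_perm s x) = content x.
Proof.
rewrite /content [RHS](reindex_perm s).
by apply: eq_bigr => i _; rewrite mxE.
Qed.

Lemma content_dvd (d : nat) (x : 'rV[int]_d) i : (content x %| `|x ord0 i|)%N.
Proof. exact: (biggcdn_inf i). Qed.

Lemma content_dvd_norm1 (d : nat) (x : 'rV[int]_d) : (content x %| norm1 x)%N.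
Proof. by apply: dvdn_sum => i _; apply: content_dvd. Qed.

(** * Duplicate-free lists of lattice points *)

Lemma box_uniq d p : uniq (box d p).
Proof.
rewrite /box map_inj_uniq ?enum_uniq // => f g /rowP eqfg.
apply/ffunP => i; apply/val_inj; have := eqfg i; rewrite !mxE => /addIr.
by case.
Qed.

Lemma mem_box d p (x : 'rV[int]_d) : (x \in box d p) = [forall i, (`|x ord0 i| <= p)%N].
Proof.
apply/mapP/forallP => [[f _ ->] i|lexp]; first by rewrite mxE; case: (f i) => k /= ltk; lia.
exists [ffun i => inord `|(x ord0 i + p%:Z)%R|%N]; rewrite ?mem_enum //.
by apply/rowP => i; rewrite !mxE ffunE; have := lexp i; move: (x ord0 i) => z lez;
  rewrite inordK; lia.
Qed.

Lemma mem_box_norm1 d p (x : 'rV[int]_d) : (norm1 x <= p)%N -> x \in box d p.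
Proof.
by move=> lexp; rewrite mem_box; apply/forallP => i; apply: leq_trans (leq_norm1 _ _ i) lexp.
Qed.

Definition prim_ball d p : seq 'rV[int]_d :=
  [seq x <- box d p | (norm1 x <= p)%N && (content x == 1%N)].

Definition prim_sphere d n : seq 'rV[int]_d :=
  [seq x <- box d n | (norm1 x == n) && (content x == 1%N)].

Definition sphere d n : seq 'rV[int]_d :=
  [seq x <- box d n | norm1 x == n].

Lemma mem_prim_ball d p x :
  (x \in prim_ball d p) = (norm1 x <= p)%N && (content x == 1%N).
Proof.
rewrite mem_filter andb_idr // => /andP[lexp _]; exact: mem_box_norm1.
Qed.

Lemma mem_prim_sphere d n x :
  (x \in prim_sphere d n) = (norm1 x == n) && (content x == 1%N).
Proof.
rewrite mem_filter andb_idr // => /andP[/eqP xn _]; apply: mem_box_norm1.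
by rewrite xn.
Qed.

Lemma mem_sphere d n x : (x \in sphere d n) = (norm1 x == n).
Proof.
by rewrite mem_filter andb_idr // => /eqP xn; apply: mem_box_norm1; rewrite xn.
Qed.

(** * Symmetry under negation and under permutations of the coordinates *)

Lemma perm_prim_ball d p (h g : 'rV[int]_d -> 'rV[int]_d) :
  cancel h g -> cancel g h -> (forall x, norm1 (h x) = norm1 x) ->
  (forall x, content (h x) = content x) ->
  perm_eq (map h (prim_ball d p)) (prim_ball d p).
Proof.
move=> hK gK hn hc; apply: uniq_perm.
- by rewrite map_inj_uniq ?filter_uniq ?box_uniq //; apply: can_inj hK.
- by rewrite filter_uniq ?box_uniq.
move=> x; rewrite -{1}(gK x) mem_map; last exact: can_inj hK.
by rewrite !mem_prim_ball -hn -(hc (g x)) gK.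
Qed.

Lemma BPE d p : BP d p = [seq x <- prim_ball d p | first_nz_pos x].
Proof.
rewrite /BP undup_id ?filter_uniq ?box_uniq // -filter_predI.
by apply: eq_filter => x; rewrite /= in_BE primitiveE andbA andbC.
Qed.

Lemma first_nz_posN (d : nat) (x : 'rV[int]_d) :
  x != 0 -> first_nz_pos (- x) = ~~ first_nz_pos x.
Proof.
move=> x0; have [i0 xi0] : exists i, x ord0 i != 0.
  apply/existsP; apply: contraNT x0 => /existsPn x0; apply/eqP/rowP => i.
  by rewrite mxE; apply/eqP; move: (x0 i); rewrite negbK.
case: (@arg_minnP _ i0 (fun i => x ord0 i != 0) (@nat_of_ord d) xi0) => i xi mini.
(* Here [i] is the first non-zero position of [x]. Both [x] and [- x] have the zero pattern of [x],
   so the sign at [i] decides for each. *)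
have fnpE (y : 'rV[int]_d) : (forall j, (y ord0 j == 0) = (x ord0 j == 0)) ->
    first_nz_pos y = (0 < y ord0 i).
  move=> yx; apply/existsP/idP => [[j /andP[yj /forallP zj]]|yi]; last first.
    exists i; rewrite yi; apply/forallP => j; apply/implyP; rewrite ltnNge.
    by apply: contraNT; rewrite yx => /mini.
  case: (ltngtP i j) => [ij|ji|/val_inj -> //].
    by have /implyP/(_ ij) := zj i; rewrite yx (negPf xi).
  by have := mini j; rewrite -yx (gt_eqF yj) leqNgt ji => /(_ isT).
rewrite !fnpE // => [|j]; last by rewrite mxE oppr_eq0.
by rewrite mxE oppr_gt0 -leNgt le_eqVlt (negPf xi).
Qed.

Lemma content0 d : content (0 : 'rV[int]_d) = 0%N.
Proof. by rewrite /content big1 // => i _; rewrite mxE. Qed.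

(** Negation exchanges the two halves of the ball; the origin, its only fixed point, has content 0
    and is not in the ball. *)
Lemma sum_BP d p (w : 'rV[int]_d -> nat) : (forall x, w (- x) = w x) ->
  (\sum_(x <- prim_ball d p) w x = 2 * \sum_(x <- BP d p) w x)%N.
Proof.
move=> wN; rewrite BPE big_filter (bigID (@first_nz_pos d)) /= mul2n -addnn.
congr addn.
rewrite -(perm_big _ (perm_prim_ball _ _ _ _ (@opprK _) (@opprK _) (@norm1N d) (@contentN d))) /=.
rewrite big_map big_seq_cond [RHS]big_seq_cond; apply: eq_big => [x|x _]; last exact: wN.
apply: andb_id2l; rewrite mem_prim_ball => /andP[_ xc].
rewrite first_nz_posN ?negbK //; apply: contraTneq xc => ->.
by rewrite content0.
Qed.

(** A swap of coordinates may change the sign of the first non-zero one, so it need not preserve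
    [BP]; it does preserve the full primitive ball. *)
Lemma sum_prim_ball_coord d p i j :
  (\sum_(x <- prim_ball d p) `|x ord0 i| = \sum_(x <- prim_ball d p) `|x ord0 j|)%N.
Proof.
pose s := tperm i j.
rewrite -(perm_big _ (perm_prim_ball _ _ (col_perm s) (col_perm s) _ _ (norm1_perm d s)
   (content_perm d s))) /=.
- by rewrite big_map; apply: eq_bigr => x _; rewrite mxE tpermL.
- by move=> x; apply/rowP => k; rewrite !mxE tpermK.
- by move=> x; apply/rowP => k; rewrite !mxE tpermK.
Qed.

Lemma kappaE d p : (0 < d)%N ->
  (2 * d * kappa (BP d p) = \sum_(x <- prim_ball d p) norm1 x)%N.
Proof.
case: d => // d _; rewrite /kappa.
have sumE i : (2 * (\sum_(x <- BP d.+1 p) `|x ord0 i|) =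
      \sum_(x <- prim_ball d.+1 p) `|x ord0 ord0|)%N.
  by rewrite (sum_prim_ball_coord _ _ _ i) -sum_BP // => x; rewrite mxE abszN.
have eqi i : (\sum_(x <- BP d.+1 p) `|x ord0 i| = \sum_(x <- BP d.+1 p) `|x ord0 ord0|)%N.
  by apply/eqP; rewrite -(eqn_pmul2l (isT : 0 < 2)%N) !sumE.
rewrite (eq_bigr _ (fun i _ => eqi i)).
have -> : (\max_(i < d.+1) \sum_(x <- BP d.+1 p) `|x ord0 ord0| =
    \sum_(x <- BP d.+1 p) `|x ord0 ord0|)%N.
  by apply/eqP; rewrite eqn_leq (leq_bigmax (F := fun=> _) ord0) andbT; apply/bigmax_leqP.
rewrite [RHS]exchange_big.
under [RHS]eq_bigr => i _ do rewrite (sum_prim_ball_coord _ _ i ord0) -(sumE ord0).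
by rewrite sum_nat_const card_ord mulnA [(2 * _)%N]mulnC.
Qed.

(** * Decomposition of a sphere according to content *)

Lemma size_sphere_divisors d n : (0 < n)%N ->
  size (sphere d n) = (\sum_(e <- divisors n) size (prim_sphere d e))%N.
Proof.
move=> n0.
(* Scaling by n/e maps the primitive points of norm e bijectively onto the points of norm n and
   content n/e. *)
have fiber e : (e %| n)%N ->
    size (prim_sphere d e) = (\sum_(x <- sphere d n) (content x * e == n))%N.
  move=> en; have e0 := dvdn_gt0 n0 en; have c0 : (0 < n %/ e)%N by rewrite divn_gt0 // dvdn_leq.
  rewrite -(size_map (fun x => (n %/ e)%N%:Z *: x)) -sum1_size.
  transitivity (\sum_(x <- sphere d n | (content x * e == n)%N) 1)%N; last first.
    by rewrite big_mkcond; apply: eq_bigr => x _; case: eqP.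
  rewrite -[RHS]big_filter; apply: perm_big; apply: uniq_perm.
  - rewrite map_inj_uniq ?filter_uniq ?box_uniq //; move=> x y /rowP eqxy.
    apply/rowP => i; have := eqxy i; rewrite !mxE; apply: mulfI.
    by rewrite eqz_nat -lt0n.
  - by rewrite !filter_uniq ?box_uniq.
  move=> x; rewrite mem_filter mem_sphere; apply/mapP/andP => [[y + ->]|[/eqP cx /eqP nx]].
    by rewrite mem_prim_sphere norm1Z contentZ => /andP[/eqP -> /eqP ->]; rewrite muln1 divnK.
  have cE : content x = (n %/ e)%N by rewrite -cx mulnK.
  pose y : 'rV[int]_d := \row_i (x ord0 i %/ (n %/ e)%N%:Z)%Z.
  have xE : x = (n %/ e)%N%:Z *: y.
    apply/rowP => i; rewrite !mxE mulrC divzK // dvdzE /= -cE; exact: content_dvd.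
  exists y => //; rewrite mem_prim_sphere; apply/andP; split; rewrite -(eqn_pmul2l c0).
    by rewrite -norm1Z -xE nx divnK.
  by rewrite -contentZ -xE cE muln1.
rewrite [RHS]big_seq; under eq_bigr => e en.
  rewrite -dvdn_divisors // in en; rewrite fiber //; over.
rewrite -big_seq exchange_big /= -sum1_size [LHS]big_seq [RHS]big_seq.
apply: eq_bigr => x; rewrite mem_sphere => /eqP nx.
have cn : (content x %| n)%N by rewrite -nx content_dvd_norm1.
have c0 := dvdn_gt0 n0 cn.
(* Each point is counted for exactly one divisor, the norm of its primitive part. *)
rewrite (bigD1_seq (n %/ content x)%N) ?divisors_uniq -?dvdn_divisors ?dvdn_div //=.
rewrite mulnC divnK // eqxx big1 // => e /negPf ne.
by apply/eqP; rewrite eqb0; apply: contraFN ne => /eqP <-; rewrite mulKn.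
Qed.

(** * Counting spheres by generating functions *)

Lemma sum_bin n k : (\sum_(i < n) 'C(i, k) = 'C(n, k.+1))%N.
Proof.
by elim: n => [|n IHn]; rewrite ?big_ord0 ?bin0n // big_ord_recr /= IHn binS.
Qed.

(** The truncation of X/(1 - X) after degree n, which suffices for coefficients up to n. *)
Definition geom_poly n : {poly rat} := \sum_(k < n) 'X^(k.+1).

Lemma coef_geom_poly n i : (geom_poly n)`_i = (0 < i <= n)%N%:R.
Proof.
rewrite /geom_poly coef_sum; under eq_bigr => k _ do rewrite coefXn.
case: i => [|i]; first by rewrite big1.
have [lein|ltni] := leqP i.+1 n; last first.
  by rewrite big1 // => k _; rewrite gtn_eqF // ltnS (leq_trans (ltn_ord k)).
rewrite (bigD1 (Ordinal lein)) //= eqxx big1 ?addr0 // => k /negPf nk.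
by rewrite eqSS eq_sym; rewrite -val_eqE /= in nk; rewrite nk.
Qed.

(* Both sides count the compositions of [i.+1] into [j.+1] positive parts. *)
Lemma coef_geom_polyX n j i : (i < n)%N ->
  (geom_poly n ^+ j.+1)`_i.+1 = 'C(i, j)%:R.
Proof.
elim: j i => [|j IHj] i ltin; first by rewrite expr1 coef_geom_poly ltin bin0.
rewrite exprSr coefMr big_ord_recl coef_geom_poly mulr0 add0r.
under eq_bigr => k _.
  rewrite coef_geom_poly /= (leq_trans (ltn_ord k) ltin) mulr1 /bump leq0n add1n subSS; over.
(* The summation index becomes the total of all parts but the last; the sum is then a hockey-stick
   sum, given by [sum_bin]. *)
rewrite (reindex_inj rev_ord_inj) /=.
under eq_bigr => k _ do rewrite subSS subKn ?leq_ord //.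
rewrite big_ord_recl -horner_coef0 horner_exp horner_coef0 coef_geom_poly expr0n add0r.
rewrite -sum_bin natr_sum; apply: eq_bigr => k _.
by rewrite IHj // (ltn_trans _ ltin).
Qed.

Lemma size_sphere_coef d n :
  (size (sphere d n))%:R = ((1 + geom_poly n *+ 2) ^+ d)`_n.
Proof.
(* One coordinate of the box is k - n with k from 0 to 2n: its absolute value is 0 once and each of
   1, ..., n twice. *)
have -> : 1 + geom_poly n *+ 2 = \sum_(k < (2 * n).+1) 'X^`|(k%:Z - n%:Z)%R|%N.
  rewrite -(big_mkord xpredT (fun k => 'X^`|(k%:Z - n%:Z)%R|%N)) (@big_cat_nat _ _ _ n) /=; try lia.
  rewrite [X in _ = _ + X]big_ltn; last lia.
  rewrite mulr2n subrr [RHS]addrCA; congr (_ + (_ + _)).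
    rewrite /geom_poly -(big_mkord xpredT (fun k => 'X^(k.+1))) big_nat_rev /=.
    by apply: eq_big_nat => k kn; congr 'X^_; lia.
  rewrite /geom_poly -(big_mkord xpredT (fun k => 'X^(k.+1))) -{1}[n.+1]add0n big_addn.
  have -> : ((2 * n).+1 - n.+1 = n)%N by lia.
  by apply: eq_big_nat => k kn; congr 'X^_; lia.
(* Expanding the power gives one monomial per point of the box, with its norm as exponent. *)
rewrite -[in X in _ ^+ X](card_ord d) -prodr_const bigA_distr_bigA /= coef_sum.
rewrite /sphere size_filter -sum1_count big_mkcond big_image natr_sum.
apply: eq_bigr => f _; rewrite -expr_sum coefXn eq_sym /norm1.
rewrite (eq_bigr (fun i => `|(f i)%:Z - n%:Z|%N)) => [|i _]; last by rewrite mxE.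
by case: eqP.
Qed.

Lemma size_sphere d n : (0 < n)%N ->
  (size (sphere d n))%:R =
    \sum_(1 <= j < d.+1) 2 ^+ j * 'C(d, j)%:R * 'C(n.-1, j.-1)%:R :> rat.
Proof.
case: n => // n _; rewrite size_sphere_coef addrC exprD1n coef_sum.
rewrite -(big_mkord xpredT (fun j => ((geom_poly n.+1 *+ 2) ^+ j *+ 'C(d, j))`_n.+1)).
(* The term j = 0 is constant and does not contribute to a positive degree. *)
rewrite big_ltn // expr0 coefMn coef1 mul0rn add0r; apply: eq_big_nat => -[|j] // _.
rewrite coefMn [in LHS]exprMn_n coefMn coef_geom_polyX //=.
by rewrite -[LHS]mulr_natr -[X in X * _ = _]mulr_natr natrX; ring.
Qed.

(** * From primitive spheres to weighted sums over the ball *)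

Lemma size_prim_sphere d n : (0 < n)%N ->
  (size (prim_sphere d n))%:R =
    \sum_(1 <= j < d.+1) 2 ^+ j * 'C(d, j)%:R * cpsi n j :> rat.
Proof.
move=> n0.
apply: (@eq_divisor_sum _ (fun n => (size (prim_sphere d n))%:R)
  (fun n => \sum_(1 <= j < d.+1) 2 ^+ j * 'C(d, j)%:R * cpsi n j) n); last by rewrite n0 leqnn.
move=> m /andP[m0 _].
rewrite -natr_sum -size_sphere_divisors // size_sphere // exchange_big.
by apply: eq_big_nat => j /andP[j0 _]; rewrite -big_distrr sum_cpsi.
Qed.

(** Grouping by norm reduces this to the count on spheres. The weight 1 yields (i), the identity
    yields (ii). *)
Lemma sum_prim_ball d p (F : nat -> nat) : (0 < d)%N ->
  (\sum_(x <- prim_ball d p) F (norm1 x))%:R =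
    \sum_(1 <= j < d.+1) (2 ^+ j * 'C(d, j)%:R *
       \sum_(j <= i < p.+1) (F i)%:R * cpsi i j) :> rat.
Proof.
move=> d0.
have -> : (\sum_(x <- prim_ball d p) F (norm1 x) =
    \sum_(1 <= i < p.+1) F i * size (prim_sphere d i))%N.
  transitivity (\sum_(1 <= i < p.+1) \sum_(x <- prim_ball d p | norm1 x == i) F i)%N.
    rewrite (exchange_big_dep xpredT) //= [LHS]big_seq [RHS]big_seq; apply: eq_bigr => x.
    rewrite mem_prim_ball => /andP[xp xc].
    have x0 : (0 < norm1 x)%N.
      rewrite lt0n; apply: contraTneq xc => x0.
      suff -> : x = 0 by rewrite content0.
      apply/rowP => i; rewrite mxE; apply/eqP.
      by have := leq_norm1 _ x i; rewrite x0 leqn0 absz_eq0.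
    rewrite (big_rem (norm1 x)) ?mem_index_iota ?x0 //= eqxx big_seq_cond big1 ?addn0 //.
    move=> i /andP[]; rewrite mem_rem_uniq ?iota_uniq // !inE => /andP[/negPf ni _].
    by rewrite eq_sym ni.
  apply: eq_big_nat => i /andP[_ ip].
  rewrite big_const_seq iter_addn_0; congr muln.
  rewrite -size_filter; apply: perm_size; apply: uniq_perm; rewrite ?filter_uniq ?box_uniq //.
  move=> x; rewrite mem_filter mem_prim_ball mem_prim_sphere.
  by case: eqP => //= ->; rewrite -ltnS ip.
rewrite natr_sum.
under eq_big_nat => i /andP[i0 _].
  rewrite natrM size_prim_sphere // big_distrr; over.
rewrite exchange_big /=; apply: eq_big_nat => j /andP[j0 _].
(* Terms with i < j vanish by [cpsi_small], so the inner sum may start at j; for j > p + 1 nothing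
   remains. *)
rewrite big_distrr /=; have [lejp|ltpj] := leqP j p.+1.
  rewrite (@big_cat_nat _ _ _ j) //= big_nat big1 ?add0r => [|i /andP[i0 ij]].
    by apply: eq_bigr => i _; rewrite mulrCA.
  by rewrite cpsi_small ?i0 // !mulr0.
rewrite [RHS]big_geq ?(ltnW ltpj) // big_nat big1 // => i /andP[i0 ip].
by rewrite cpsi_small ?i0 ?(ltn_trans ip) // !mulr0.
Qed.

Theorem theorem1p1 (d p : nat) (hd : (0 < d)%N) (hp : (0 < p)%N) :
  (size (BP d p))%:R =
    2^-1 * \sum_(1 <= j < d.+1) (2 ^+ j * 'C(d, j)%:R *
                                 \sum_(j <= i < p.+1) cpsi i j) :> rat
  /\
  (kappa (BP d p))%:R =
    (2 * d%:R)^-1 * \sum_(1 <= j < d.+1) (2 ^+ j * 'C(d, j)%:R *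
                                 \sum_(j <= i < p.+1) i%:R * cpsi i j) :> rat.
Proof.
have d0 : d%:R != 0 :> rat by rewrite pnatr_eq0 -lt0n.
split; last first.
  apply: (mulfI (_ : 2 * d%:R != 0)); first by rewrite mulf_neq0.
  rewrite mulVKf ?mulf_neq0 // -(sum_prim_ball d p id) // -kappaE //.
  by rewrite !natrM.
apply: (mulfI (_ : 2 != 0)) => //; rewrite mulVKf //.
have -> : 2 * (size (BP d p))%:R = (\sum_(x <- prim_ball d p) 1)%N%:R :> rat.
  by rewrite sum_BP // natrM -sum1_size.
rewrite (sum_prim_ball d p (fun=> 1%N)) //; apply: eq_bigr => j _; congr (_ * _).
by apply: eq_bigr => i _; rewrite mul1r.
Qed.
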